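(* If $m \geq 2$ is an integer, then $\chi_{pc}(K_{2*m}) > m$, where $K_{2*m}$ is the complete $m$-partite graph in which each partite set has size $2$.
   Context: All graphs are finite and simple. Let $k$ be a positive integer. A $k$-assignment $L$ for a graph $G$ assigns to each vertex $v$ a set $L(v)$ of exactly $k$ colors; its palette is $\mathcal{L} = \bigcup_{v \in V(G)} L(v)$, and for $c \in \mathcal{L}$, $\eta(c) = |\{v \in V(G) : c \in L(v)\}|$. A proper $L$-coloring of $G$ is a proper coloring $f$ of $G$ with $f(v) \in L(v)$ for every vertex $v$. It is a proportional $L$-coloring if for every $c \in \mathcal{L}$, $|f^{-1}(c)|$ equals $\lfloor \eta(c)/k \rfloor$ or $\lceil \eta(c)/k \rceil$. $G$ is proportionally $k$-choosable if a proportional $L$-coloring of $G$ exists for every $k$-assignment $L$ for $G$. The proportional choice number $\chi_{pc}(G)$ is the smallest positive integer $k$ such that $G$ is proportionally $k$-choosable. (It is known that proportional $k$-choosability implies proportional $(k+1)$-choosability.) *)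

(* Defs.v *)
From HB Require Import structures.
From mathcomp Require Import all_boot finmap boolp.

Set Implicit Arguments.
Unset Strict Implicit.
Unset Printing Implicit Defensive.

Record sgraph := SGraph {
  vertex :> finType;
  adj : rel vertex;
  adj_sym : symmetric adj;
  adj_irrefl : irreflexive adj
}.

Section Assignments.
Variables (G : sgraph) (C : choiceType).
Implicit Types (L : G -> {fset C}) (f : G -> C) (k : nat).

Definition assignment k L : Prop := forall v, #|` L v| = k.

Definition palette L : {pred C} := [pred c | [exists v, c \in L v]].

Definition eta L (c : C) : nat := #|[set v : G | c \in L v]|.

Definition proper_coloring f : Prop := forall u v, adj u v -> f u != f v.

Definition proper_list_coloring L f : Prop :=
  proper_coloring f /\ forall v, f v \in L v.

Definition color_class f (c : C) : {set G} := [set v | f v == c].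

End Assignments.

(* The ceiling of n / d, for d > 0. *)
Definition ceil_div (n d : nat) : nat := (n + d.-1) %/ d.

Definition proportional_coloring (G : sgraph) (C : choiceType) (k : nat)
    (L : G -> {fset C}) (f : G -> C) : Prop :=
  proper_list_coloring L f /\
  forall c, c \in palette L ->
    #|color_class f c| = eta L c %/ k \/
    #|color_class f c| = ceil_div (eta L c) k.

(* Colors may come from an arbitrary choiceType; only finitely many are used. *)
Definition proportionally_choosable (k : nat) (G : sgraph) : Prop :=
  forall (C : choiceType) (L : G -> {fset C}), assignment k L ->
    exists f, proportional_coloring k L f.

Lemma distinct_representatives (V : finType) (C : choiceType)
    (L : V -> {fset C}) :
  (forall v, #|V| <= #|` L v|) ->
  exists2 f : V -> C, injective f & forall v, f v \in L v.
Proof.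
move=> hL.
have [V0|[v0]] : #|V| = 0 \/ inhabited V.
- case: (posnP #|V|) => [->|/card_gt0P[v _]]; [by left | by right].
- have F (v : V) : False by have := fintype0 v V0.
  by exists (fun v => match F v with end) => v; case: (F v).
have [x0 _] : exists x, x \in L v0.
  apply/fset0Pn; rewrite -cardfs_gt0; apply: leq_trans (hL v0).
  by apply/card_gt0P; exists v0.
suff H (s : seq V) : uniq s -> exists2 f : V -> C,
    {in s &, injective f} & {in s, forall v, f v \in L v}.
  have [f fI fL] := H (enum V) (enum_uniq V).
  by exists f => [u v|v]; [apply: fI; rewrite mem_enum | apply: fL; rewrite mem_enum].
elim: s => [_|v s IHs /= /andP[vs us]]; first by exists (fun=> x0).
have [f fI fL] := IHs us.
have [x xL xs] : exists2 x, x \in L v & x \notin [seq f u | u <- s].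
  have [D0|/fset0Pn[x]] :=
      eqVneq (L v `\` [fset y in [seq f u | u <- s]])%fset fset0; last first.
    by rewrite !inE => /andP[xs xL]; exists x.
  have := hL v; rewrite leqNgt => /negP[].
  move/eqP: D0; rewrite fsetD_eq0 => /fsubset_leq_card /leq_ltn_trans; apply.
  apply: (@leq_trans (size s).+1).
    by rewrite ltnS card_fseq (leq_trans (size_undup _)) ?size_map.
  by have /card_uniqP/= <- : uniq (v :: s) by [rewrite /= vs]; apply: max_card.
exists (fun u => if u == v then x else f u) => [a b|a]; rewrite !inE.
- case: (eqVneq a v) => [->|_] /=; case: (eqVneq b v) => [->|_] //=.
  + by move=> _ bs xE; rewrite xE map_f in xs.
  + by move=> as_ _ xE; rewrite -xE map_f in xs.
  + exact: fI.
- by case: (eqVneq a v) => [->|_] //= /fL.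
Qed.

Lemma proportionally_choosable_ex (G : sgraph) :
  exists k, (0 < k) && `[< proportionally_choosable k G >].
Proof.
exists #|G|.+1; apply/andP; split=> //; apply/asboolP => C L hL.
have [v|f fI fL] := @distinct_representatives G C L; first by rewrite hL leqnSn.
exists f; split.
  split=> // u v; apply: contraTN => /eqP/fI ->.
  by rewrite adj_irrefl.
move=> c /existsP[v vc].
have eta_gt0 : 0 < eta L c by apply/card_gt0P; exists v; rewrite inE.
have eta_le : eta L c < #|G|.+1 by rewrite ltnS max_card.
have -> : ceil_div (eta L c) #|G|.+1 = 1.
  rewrite /ceil_div /= -(subnK eta_gt0) addn1 addSnnS divnDr ?dvdnn //.
  rewrite divnn /= divn_small //.
  by apply: leq_ltn_trans eta_le; rewrite leq_subr.
rewrite divn_small //.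
have : #|color_class f c| <= 1.
  apply/card_le1_eqP => a b; rewrite !inE => /eqP fa /eqP fb.
  by apply: fI; rewrite fa fb.
by case: #|_| => [|[|]] //; [left | right].
Qed.

(* The predicate quantifies over all color types and assignments, hence the
   classical reflection into bool. *)
Definition chi_pc (G : sgraph) : nat := ex_minn (proportionally_choosable_ex G).

Section CompleteMultipartite.
Variables s m : nat.

Definition cmp_adj : rel ('I_m * 'I_s) := fun x y => x.1 != y.1.

Lemma cmp_adj_sym : symmetric cmp_adj.
Proof. by move=> x y; rewrite /cmp_adj eq_sym. Qed.

Lemma cmp_adj_irrefl : irreflexive cmp_adj.
Proof. by move=> x; rewrite /cmp_adj eqxx. Qed.

(* K_{s*m}: m partite sets of size s; the first component of a vertex is its
   partite set. *)
Definition complete_multipartite : sgraph := SGraph cmp_adj_sym cmp_adj_irrefl.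

End CompleteMultipartite.

(* Main.v *)
Require Import Defs.
From mathcomp Require Import all_boot.
From mathcomp Require Import finmap boolp.

(** Let [2 <= k <= m], and give both vertices of each part the same list: [k - 1]
    colors common to all vertices and one color private to that part.  A
    private color has [eta = 2], so a proportional coloring uses it at most
    once.  In a proper coloring a common color occurs in at most one part, so
    some part has no common color; both its vertices then get its private
    color, a contradiction.  (For [k = 1] the graph is not even [k]-colorable.) *)

(* The common colors are [0, ..., k - 2]; the private one of part [j] is [j + (k - 1)]. *)
Definition private_color_lists (k m : nat) (v : 'I_m * 'I_2) : {fset nat} :=
  [fset x in (v.1 + k.-1)%N :: iota 0 k.-1]%fset.

Lemma in_private_color_lists k m (v : 'I_m * 'I_2) c :
  (c \in private_color_lists k m v) = (c == v.1 + k.-1) || (c < k.-1).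
Proof. by rewrite !inE mem_iota. Qed.

Lemma private_color_lists_assignment k m : 0 < k ->
  @assignment (complete_multipartite 2 m) _ k (private_color_lists k m).
Proof.
move=> k_gt0 v; rewrite card_fseq undup_id /= ?size_iota ?prednK //.
by rewrite mem_iota iota_uniq add0n -leqNgt leq_addl.
Qed.

Lemma eta_private_color k m (j : 'I_m) :
  @eta (complete_multipartite 2 m) _ (private_color_lists k m) (j + k.-1) = 2.
Proof.
have card_part : #|setX [set j] [set: 'I_2]| = 2.
  by rewrite cardsX cards1 cardsT card_ord.
rewrite -[RHS]card_part; apply: eq_card => -[i s]; rewrite in_setX in_set in_private_color_lists !inE andbT.
by rewrite eqn_add2r ltnNge leq_addl orbF eq_sym.
Qed.

(** Pigeonhole: otherwise, choosing in each part a vertex with a common color maps the $m$ parts to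
    the $k - 1$ common colors. Vertices of distinct parts are adjacent, so this map is injective,
    whence $m \le k - 1$. *)
Lemma part_without_common_colors k m (f : complete_multipartite 2 m -> nat) :
  0 < k <= m -> proper_coloring f -> exists j, forall s, k.-1 <= f (j, s).
Proof.
move=> /andP[k_gt0 k_le_m] f_proper.
suff /existsP[j /forallP fj] : [exists j, forall s, k.-1 <= f (j, s)] by exists j.
apply: contraLR k_le_m; rewrite negb_exists => /forallP common.
rewrite -ltnNge -(prednK k_gt0) ltnS.
have {}common j : exists s, f (j, s) < k.-1.
  by have := common j; rewrite negb_forall => /existsP[s]; rewrite -ltnNge; exists s.
have [s fs] := choice common.
have /leq_card : injective (fun j => Ordinal (fs j)).
  move=> i j [] /eqP; apply: contraTeq => ij.
  exact: f_proper.
by rewrite !card_ord.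
Qed.

Lemma K2m_not_proportionally_choosable k m : 1 < m -> 0 < k <= m ->
  ~ proportionally_choosable k (complete_multipartite 2 m).
Proof.
move=> m_gt1 /andP[k_gt0 k_le_m] choosable.
have [k1|k_neq1] := eqVneq k 1.
  have [v|f [[f_proper fL] _]] := choosable nat (fun=> [fset 0]%fset).
    by rewrite cardfs1 k1.
  (* Parts [0] and [1] exist as $m \ge 2$; these adjacent vertices are both forced to take color
     [0]. *)
  pose u : complete_multipartite 2 m := (Ordinal (ltnW m_gt1), ord0).
  pose v : complete_multipartite 2 m := (Ordinal m_gt1, ord0).
  have := f_proper u v erefl.
  by move: (fL u) (fL v); rewrite !inE => /eqP-> /eqP->.
have k_gt1 : 1 < k by rewrite ltn_neqAle eq_sym k_neq1.
have [f [[f_proper fL] f_prop]] := choosable _ _ (@private_color_lists_assignment k m k_gt0).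
have [|j fj] := @part_without_common_colors k m f _ f_proper; first by rewrite k_gt0.
have fjE s : f (j, s) = j + k.-1.
  have := fL (j, s); rewrite in_private_color_lists => /orP[/eqP //|].
  by rewrite ltnNge fj.
have in_palette : j + k.-1 \in
    @palette (complete_multipartite 2 m) _ (private_color_lists k m).
  by apply/existsP; exists (j, ord0); rewrite in_private_color_lists eqxx.
have class_ge2 : 1 < #|color_class f (j + k.-1)|.
  apply/card_gt1P; exists (j, ord0), (j, ord_max).
  by split; rewrite ?inE ?fjE ?xpair_eqE ?eqxx.
have class_le1 : #|color_class f (j + k.-1)| <= 1.
  (* Here $k \ge 2$ matters: it gives $2 < 2k$ for the floor of $2/k$ and $k + 1 < 2k$ for its
     ceiling, so both are at most $1$. *)
  have := f_prop _ in_palette; rewrite eta_private_color => -[] ->.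
    by rewrite -ltnS ltn_divLR // (leq_trans _ (leq_mul (leqnn 2) k_gt1)).
  by rewrite /ceil_div -ltnS ltn_divLR // add2n prednK // mul2n -addnn -[k.+1]add1n ltn_add2r.
by move: class_le1; rewrite leqNgt class_ge2.
Qed.

Theorem proposition26 (m : nat) (hm : 2 <= m) :
  m < chi_pc (complete_multipartite 2 m).
Proof.
rewrite /chi_pc; case: ex_minnP => k /andP[k_gt0 /asboolP choosable] _.
rewrite ltnNge; apply/negP => k_le_m.
by apply: K2m_not_proportionally_choosable choosable; rewrite ?k_gt0.
Qed.
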